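(* Let $k$ be an algebraically closed field of characteristic $p>0$, let $n\ge 1$ and let $d\geq n$. Let $L$ be the smallest positive integer, if one exists, such that (a) $p^L\frac{n}{d}$ is not an integer, and (b) the remainder when $np^L$ is divided by $d$ is strictly less than $n$. If such an $L$ exists, then the $F$-pure threshold of a generic element of $\mathbb P(\mathrm{Sym}^d(k^n)^* )$ (equivalently, the maximum value of the $F$-pure threshold of any homogeneous polynomial of degree $d$ in $n$ variables over $k$) is the truncation $\langle \frac{n}{d}\rangle_L$. If no such $L$ exists, then this generic (maximum) value of the $F$-pure threshold is $\frac{n}{d}$.
   Context: For a nonzero homogeneous $f\in k[x_1,\dots,x_n]$ of positive degree, with $\mathfrak m=(x_1,\dots,x_n)$ and $\mathfrak m^{[p^e]}=(x_1^{p^e},\dots,x_n^{p^e})$, the $F$-pure threshold is $\mathrm{fpt}(f)=\sup\{N/p^e : f^N\notin \mathfrak m^{[p^e]}\}=\inf\{N/p^e: f^N\in\mathfrak m^{[p^e]}\}$. $\mathbb P(\mathrm{Sym}^d(k^n)^* )$ is the projective space of nonzero homogeneous polynomials of degree $d$ in $n$ variables up to nonzero scalar. The $F$-pure threshold takes a maximal value on it, and this value is attained exactly on a dense Zariski-open subset; it is called the generic value. For a real number $0<\lambda\le 1$, write its unique non-terminating base $p$ expansion $\lambda=\sum_{i\ge1}\alpha_i/p^i$ (integers $0\le\alpha_i\le p-1$, the sequence $(\alpha_i)$ not eventually zero). Then $\langle\lambda\rangle_e:=\sum_{i=1}^e\alpha_i/p^i$; equivalently $\langle \lambda\rangle_e=N_e/p^e$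 with $N_e$ the unique integer such that $0<\lambda-N_e/p^e\le 1/p^e$. *)

(* Defs.v *)
From HB Require Import structures.
From mathcomp Require Import all_boot all_order all_algebra.
From mathcomp Require Import mpoly.
From mathcomp Require Import boolp classical_sets reals.
From mathcomp Require Import topology normedtype sequences.

Set Implicit Arguments.
Unset Strict Implicit.
Unset Printing Implicit Defensive.

Import Order.TTheory GRing.Theory Num.Theory.
Import numFieldNormedType.Exports.

Local Open Scope classical_set_scope.
Local Open Scope ring_scope.

Section FPureThreshold.
Variables (k : fieldType) (n : nat).
Implicit Types f : {mpoly k[n]}.

(* The ideal (x_1^q, ..., x_n^q); for q = p ^ e it is m^[p^e]. *)
Definition frob_power_max (q : nat) : set {mpoly k[n]} :=
  [set f | exists g : 'I_n -> {mpoly k[n]}, f = \sum_(i < n) g i * 'X_i ^+ q].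

(* Meaningful for p the characteristic of k and f a nonzero form of positive
   degree: the set is then nonempty and bounded, as sup requires. *)
Definition fpt (R : realType) (p : nat) f : R :=
  sup [set x : R | exists N e : nat,
         ~ frob_power_max (p ^ e) (f ^+ N) /\ x = N%:R / (p ^ e)%:R].

End FPureThreshold.

Section BaseExpansion.
Variable R : realType.
Implicit Types (p : nat) (lam : R) (a : nat -> nat).

(* The sequence a is indexed from 0: a i is the digit alpha_(i+1), of weight
   p^-(i+1). *)
Definition expansion_term p a (i : nat) : R := (a i)%:R / (p ^ i.+1)%:R.

Definition nonterminating_expansion p lam a : Prop :=
  [/\ forall i, (a i < p)%N,
      forall m, exists2 i, (m <= i)%N & a i != 0%N &
      series (expansion_term p a) @ \oo --> lam].

(* The unique such sequence when 1 < p and 0 < lam <= 1. *)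
Definition nonterminating_digits p lam : nat -> nat :=
  get (nonterminating_expansion p lam).

Definition truncation p lam (e : nat) : R :=
  \sum_(i < e) expansion_term p (nonterminating_digits p lam) i.

End BaseExpansion.

Section ProjectiveSpace.
Variables (k : fieldType) (V : vectType k).

(* P(V), as the set of lines of V. *)
Definition proj_space := {U : {vspace V} | \dim U == 1%N}.

Definition coords (u : V) : 'I_(\dim {:V}) -> k :=
  fun i => coord (vbasis {:V}) i u.

Definition proj_zero_locus (S : set {mpoly k[\dim {:V}]}) : set proj_space :=
  [set x : proj_space | forall P, S P ->
     forall u : V, u \in val x -> P.@[coords u] = 0].

Definition zariski_closed (A : set proj_space) : Prop :=
  exists S : set {mpoly k[\dim {:V}]},
    (forall P, S P -> exists e : nat, P \is e.-homog) /\ A = proj_zero_locus S.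

Definition zariski_open (A : set proj_space) : Prop := zariski_closed (~` A).

Definition zariski_dense (A : set proj_space) : Prop :=
  forall O : set proj_space, zariski_open O -> O !=set0 -> (A `&` O) !=set0.

End ProjectiveSpace.

Section GenericValue.
Variables (R : realType) (k : fieldType) (p n d : nat).

(* The forms of degree d are taken in n.+1 variables, because dhomog n.+1 k d
   has a vectType structure but dhomog n k d does not. *)

Definition is_max_fpt (v : R) : Prop :=
  (exists f : dhomog n.+1 k d, f != 0 /\ fpt R p f = v) /\
  (forall f : dhomog n.+1 k d, f != 0 -> fpt R p f <= v).

(* fpt is invariant under nonzero scalars, so quantifying over all the nonzero
   forms on the line x amounts to choosing one. *)
Definition fpt_locus (v : R) : set (proj_space (dhomog n.+1 k d)) :=
  [set x : proj_space _ | forall f : dhomog n.+1 k d,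
     f \in val x -> f != 0 -> fpt R p f = v].

Definition is_generic_fpt (v : R) : Prop :=
  [/\ is_max_fpt v, zariski_open (fpt_locus v) & zariski_dense (fpt_locus v)].

End GenericValue.

Definition truncation_place (p n d L : nat) : Prop :=
  [/\ (0 < L)%N,
      ((p ^ L)%:R * (n%:R / d%:R) : rat) \isn't a Num.int &
      ((n * p ^ L) %% d < n)%N].

(* Main.v *)
(* Write N_e = ceil (p ^ e lam) - 1 for the expected value lam. If f has degree
   d, then f ^ N lies in m^[p^e] as soon as its degree d N exceeds m (p ^ e - 1),
   m being the number of variables: this bounds fpt f by lam.
   Conversely, if d N_e <= m (p ^ e - 1) for all e, some f has
   f ^ N_e notin m^[p^e]: build f digit by digit, where Frobenius raises a
   nonzero coefficient of f ^ N to one of f ^ (p N), and where f ^ K is turned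
   into f ^ (K + 1), for p not dividing K + 1, by adding to f a multiple of a
   monomial.
   Finally fpt f = lam iff f ^ N_e notin m^[p^e] for all e. The base p digits of
   the rational lam are eventually periodic, so the functionals sending g of
   degree < d to a coefficient of f ^ N_e g arise by iterating fixed
   p^t-semilinear maps of a space whose dimension does not depend on f. Hence a
   single e suffices for all f, and the condition is open. *)

Require Import Defs.
From HB Require Import structures.
From mathcomp Require Import all_boot all_order all_algebra.
From mathcomp Require Import mpoly.
From mathcomp Require Import boolp classical_sets reals.
From mathcomp Require Import topology normedtype sequences.
From mathcomp Require Import all_solvable zify.

Set Implicit Arguments.
Unset Strict Implicit.
Unset Printing Implicit Defensive.

Import Order.TTheory GRing.Theory Num.Theory.
Import numFieldNormedType.Exports.

Local Open Scope ring_scope.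

(** * Frobenius powers of the maximal ideal, tested on coefficients *)

Section FrobeniusPowers.
Variables (k : fieldType) (n p : nat).
Hypothesis char_k : p \in [pchar k].
Implicit Types (f g h : {mpoly k[n]}) (a b c m : 'X_{1..n}).

Let p_gt1 : (1 < p)%N.
Proof. by apply/prime_gt1/(pcharf_prime char_k). Qed.

Let pX_gt0 e : (0 < p ^ e)%N.
Proof. by rewrite expn_gt0 (ltnW p_gt1). Qed.

Lemma mcoeffMX_eq0 g m b : ~~ (m <= b)%MM -> (g * 'X_[m])@_b = 0.
Proof.
apply: contraNeq; rewrite -mcoeff_msupp (perm_mem (msuppMX _ _)).
by case/mapP=> c _ ->; apply/mnm_lepP => i; rewrite mnmDE leq_addr.
Qed.

Lemma mcoeffM_neq0 g h m : (g * h)@_m != 0 ->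
  exists a b, [/\ m = (a + b)%MM, g@_a != 0 & h@_b != 0].
Proof.
rewrite -mcoeff_msupp => /msuppM_le/allpairsP[[a b] /= [ha hb ->]].
by exists a, b; rewrite -!mcoeff_msupp.
Qed.

(** The ideal is generated by monomials, so each monomial of the support of [g] is tested
    separately. *)
Lemma frob_power_maxP q g :
  ~ frob_power_max q g <-> exists2 b : 'X_{1..n}, (forall i, (b i < q)%N) & g@_b != 0.
Proof.
split=> [hg|[b hb gb] [h hE]]; last first.
  case/eqP: gb; rewrite hE raddf_sum big1 //= => i _.
  rewrite mpolyXn mcoeffMX_eq0 //; apply/mnm_lepP => /(_ i).
  by rewrite mulmnE mnm1E eqxx mul1n leqNgt hb.
apply: contrapT => hb; apply: hg.
have fD u v : frob_power_max q u -> frob_power_max q v -> frob_power_max q (u + v).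
  move=> [u' ->] [v' ->]; exists (fun i => u' i + v' i).
  by rewrite -big_split /=; apply: eq_bigr => i _; rewrite mulrDl.
rewrite [g]mpolyE big_seq; elim/big_rec: _ => [|m u hm hu].
  by exists (fun=> 0); rewrite big1 // => i _; rewrite mul0r.
apply: fD => //.
have [i hi] : exists i, (q <= m i)%N.
  apply: contrapT => hq; apply: hb; exists m; last by rewrite -mcoeff_msupp.
  by move=> i; rewrite ltnNge; apply/negP => ?; apply: hq; exists i.
exists (fun j => if j == i then g@_m *: 'X_[m - U_(i) *+ q] else 0).
rewrite (bigD1 i) //= eqxx big1 ?addr0 => [|j /negbTE->]; last by rewrite mul0r.
rewrite mpolyXn -scalerAl -mpolyXD submK //; apply/mnm_lepP => j.
by rewrite mulmnE mnm1E; case: eqP => [<-|]; rewrite ?mul1n.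
Qed.

Lemma pchar_mpoly : p \in [pchar {mpoly k[n]}].
Proof. by rewrite pchar_lalg. Qed.

Lemma frobenius_mpolyE e g :
  g ^+ (p ^ e) = \sum_(m <- msupp g) g@_m ^+ (p ^ e) *: 'X_[m *+ (p ^ e)].
Proof.
rewrite {1}[g]mpolyE.
rewrite (big_morph (fun u : {mpoly k[n]} => u ^+ (p ^ e))
  (id1 := 0) (op1 := +%R)).
- by apply: eq_bigr => m _; rewrite exprZn mpolyXn.
- move=> u v; apply: exprDn_pchar.
  by rewrite pnatX (pnatE _ (pcharf_prime char_k)) pchar_mpoly.
- by rewrite expr0n; case: (p ^ e)%N (pX_gt0 e).
Qed.

Lemma mnm_divE q b c b' c' :
  (forall i, (c i < q)%N) -> (forall i, (c' i < q)%N) ->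
  (b *+ q + c == b' *+ q + c')%MM = (b == b') && (c == c').
Proof.
move=> hc hc'; apply/eqP/andP=> [/mnmP hE|[/eqP-> /eqP->] //].
have hi i : b i = b' i /\ c i = c' i.
  have := hE i; rewrite !mnmDE !mulmnE => hEi.
  have q0 : (0 < q)%N by apply: leq_trans (hc i).
  split.
    by have := congr1 (divn^~ q) hEi; rewrite !divnMDl // !divn_small // !addn0.
  by have := congr1 (modn^~ q) hEi; rewrite !modnMDl !modn_small.
by split; apply/eqP/mnmP => i; case: (hi i).
Qed.

(** Division of exponents by [p ^ e] is unique: the monomials with all exponents below [p ^ e] are
    linearly independent over the [p ^ e]-th powers. *)
Lemma mcoeff_frobeniusMX e g b c c' :
  (forall i, (c i < p ^ e)%N) -> (forall i, (c' i < p ^ e)%N) ->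
  (g ^+ (p ^ e) * 'X_[c])@_(b *+ (p ^ e) + c') =
    if c == c' then g@_b ^+ (p ^ e) else 0.
Proof.
move=> hc hc'; rewrite frobenius_mpolyE mulr_suml raddf_sum /=.
under eq_bigr => m _.
  rewrite -scalerAl -mpolyXD mcoeffZ mcoeffX mnm_divE //.
  over.
case: ifP => cc'; last by rewrite big1 // => m _; rewrite andbF mulr0.
have [bg|] := boolP (b \in msupp g).
  rewrite (bigD1_seq b) //= eqxx mulr1 big1 ?addr0 // => m /negbTE ->.
  by rewrite mulr0.
move=> nbg; have /eqP -> : g@_b == 0 by rewrite mcoeff_eq0.
rewrite expr0n gtn_eqF ?pX_gt0 //= big_seq big1 // => m mg.
by case: eqP mg nbg => [->->|] //; rewrite mulr0.
Qed.

Lemma mcoeff_frobenius e g b :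
  (g ^+ (p ^ e))@_(b *+ (p ^ e)) = g@_b ^+ (p ^ e).
Proof.
have := @mcoeff_frobeniusMX e g b 0%MM 0%MM.
by rewrite mpolyX0 mulr1 addm0 eqxx; apply=> i; rewrite mnm0E pX_gt0.
Qed.

Lemma msupp_frobenius e g b : (g ^+ (p ^ e))@_b != 0 ->
  exists2 m, b = (m *+ (p ^ e))%MM & g@_m != 0.
Proof.
rewrite frobenius_mpolyE raddf_sum /= => hb.
have [/hasP[m mg /eqP bE]|/hasPn hn] :=
    boolP (has (fun m => (m *+ (p ^ e))%MM == b) (msupp g)).
  by exists m => //; rewrite -mcoeff_msupp.
case/eqP: hb; rewrite big_seq big1 // => m /hn /negbTE hm.
by rewrite mcoeffZ mcoeffX hm mulr0.
Qed.

(** Otherwise [f ^ (N * p ^ e')] is a multiple of [(f ^ N') ^ (p ^ e)], and a surviving monomial of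
    [f ^ N] yields a surviving monomial of [f ^ N']. This gives access to [fpt] as an infimum. *)
Lemma frob_power_max_ratio f N e N' e' :
  ~ frob_power_max (p ^ e) (f ^+ N) ->
  frob_power_max (p ^ e') (f ^+ N') -> (N * p ^ e' < N' * p ^ e)%N.
Proof.
move=> /frob_power_maxP[b hb fb] hN'; rewrite ltnNge; apply/negP => le_N.
have : (f ^+ (N * p ^ e'))@_(b *+ (p ^ e')) != 0.
  by rewrite exprM mcoeff_frobenius expf_neq0.
rewrite -(subnKC le_N) exprD => /mcoeffM_neq0[a [c [bE]]].
rewrite exprM => /msupp_frobenius[m aE fm] _.
have : ~ ~ frob_power_max (p ^ e') (f ^+ N') by [].
apply; apply/frob_power_maxP; exists m => // i.
have := congr1 (fun u : 'X_{1..n} => u i) bE; rewrite mnmDE aE !mulmnE => hi.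
have le_i : (m i * p ^ e <= b i * p ^ e')%N by rewrite hi leq_addr.
have lt_i : (b i * p ^ e' < p ^ e * p ^ e')%N by rewrite ltn_pmul2r.
by move: (leq_ltn_trans le_i lt_i); rewrite mulnC ltn_pmul2l.
Qed.

(** A monomial with all [n] exponents at most [q - 1] has degree at most [n * (q - 1)]. *)
Lemma frob_power_max_deg d f N q : f \is d.-homog ->
  ~ frob_power_max q (f ^+ N) -> (d * N + n <= n * q)%N.
Proof.
move=> hf /frob_power_maxP[b hb fb].
have <- : mdeg b = (d * N)%N.
  by apply: (dhomog_mf (dhomogMn N hf)); rewrite mcoeff_msupp.
rewrite mdegE -[X in (_ + X)%N]card_ord -sum1_card -big_split /=.
rewrite -[X in (X * q)%N]card_ord -sum_nat_const.
by apply: leq_sum => i _; rewrite addn1.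
Qed.

End FrobeniusPowers.

(** * Forms with a power outside a Frobenius power *)

Lemma sub_mnm_deg n d (m : 'X_{1..n}) : (d <= mdeg m)%N ->
  exists2 a, (a <= m)%MM & mdeg a = d.
Proof.
elim: d => [|d IHd] ltd.
  by exists 0%MM; rewrite ?mdeg0 //; apply/mnm_lepP => i; rewrite mnm0E.
have [a am da] := IHd (ltnW ltd).
have [i ai] : exists i, (a i < m i)%N.
  apply: contrapT => ha; move: ltd; rewrite -da ltnNge; case/negP.
  rewrite !mdegE; apply: leq_sum => i _; rewrite leqNgt.
  by apply/negP => ?; apply: ha; exists i.
exists (a + U_(i))%MM; last by rewrite mdegD mdeg1 da addn1.
apply/mnm_lepP => j; rewrite mnmDE mnm1E.
by case: eqP => [<-|_]; rewrite ?addn1 // addn0; apply/mnm_lepP: j.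
Qed.

Section Existence.
Variables (k : closedFieldType) (n p d : nat).
Hypotheses (char_k : p \in [pchar k]) (d_gt0 : (0 < d)%N).
Implicit Types (f : {mpoly k[n.+1]}) (a b : 'X_{1..n.+1}).

(* The coefficient is a polynomial in c, whose derivative at c = 0 is
   (K + 1) times the coefficient of b in f ^ K. *)
Lemma mcoeff_expS_perturb f K a b :
  (f ^+ K)@_b != 0 -> K.+1%:R != 0 :> k ->
  exists c, ((f + c *: 'X_[a]) ^+ K.+1)@_(b + a) != 0.
Proof.
move=> fb K0.
pose h := \poly_(i < K.+2)
  ((f ^+ (K.+1 - i) * 'X_[a] ^+ i)@_(b + a) *+ 'C(K.+1, i)).
have h0 : h != 0.
  apply/eqP => /(congr1 (fun u : {poly k} => u`_1)).
  rewrite coef0 coef_poly /= bin1 subn1 /= expr1 addmC mcoeffMX.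
  by apply/eqP; rewrite -mulr_natr mulf_neq0.
have /closed_nonrootP[c hc] := h0; exists c.
suff -> : ((f + c *: 'X_[a]) ^+ K.+1)@_(b + a) = h.[c] by [].
rewrite horner_poly exprDn raddf_sum /=; apply: eq_bigr => i _.
by rewrite exprZn -scalerAr mcoeffMn mcoeffZ mulrnAl mulrC.
Qed.

(** The exponent grows by one at a time, never reaching a multiple of the characteristic; the degree
    bound leaves room for one more monomial of degree [d] at each step. *)
Lemma form_pow_add_digit q f N b alpha :
  (forall j, (j < alpha)%N -> (N + j).+1%:R != 0 :> k) ->
  f \is d.-homog -> f != 0 -> (f ^+ N)@_b != 0 -> (forall i, (b i < q)%N) ->
  (d * (N + alpha) + n.+1 <= n.+1 * q)%N ->
  exists f' b', [/\ f' \is d.-homog, f' != 0, (f' ^+ (N + alpha))@_b' != 0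
    & forall i, (b' i < q)%N].
Proof.
elim: alpha => [|al IH] hN hf f0 fb hb hq; first by exists f, b; rewrite addn0.
have [] // := IH; first by move=> j hj; apply: hN; apply: ltnW.
  by apply: leq_trans hq; rewrite leq_add2r leq_mul2l leq_add2l leqnSn orbT.
move=> f1 [b1 [hf1 _ fb1 hb1]].
(* The complement of [b1] in the largest monomial outside the ideal: any divisor [a] of it keeps the
   exponents of [b1 + a] below [q]. *)
pose m := [multinom (q.-1 - b1 i)%N | i < n.+1].
have degb1 : mdeg b1 = (d * (N + al))%N.
  by apply: (dhomog_mf (dhomogMn (N + al) hf1)); rewrite mcoeff_msupp.
have degm : (mdeg m + mdeg b1 + n.+1 = n.+1 * q)%N.
  rewrite !mdegE -big_split /= -[X in (_ + X)%N]card_ord -sum1_card.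
  rewrite -big_split -[X in (X * q)%N]card_ord -sum_nat_const /=.
  by apply: eq_bigr => i _; rewrite mnmE; have := hb1 i; lia.
have [|a am dega] := @sub_mnm_deg _ d m.
  by move: hq; rewrite -degm degb1 (addnS N) mulnS leq_add2r leq_add2r.
have [|c hc] := mcoeff_expS_perturb a fb1; first exact: hN.
exists (f1 + c *: 'X_[a]), (b1 + a)%MM; rewrite addnS; split=> //.
- by rewrite rpredD // rpredZ // dhomogX; apply/eqP.
- by apply: contraNneq hc => ->; rewrite exprS mul0r mcoeff0.
- move=> i; rewrite mnmDE; have := mnm_lepP am i; rewrite mnmE.
  by have := hb1 i; lia.
Qed.

(** Induction on the number of base [p] digits of [N]: the quotients [N %/ p ^ i] are its leading
    parts, and each must satisfy the degree bound. *)
Lemma exists_form_pow_notin e N :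
  (forall i, (i <= e)%N -> d * (N %/ p ^ i) + n.+1 <= n.+1 * p ^ (e - i))%N ->
  exists f b, [/\ f \is d.-homog, f != 0, (f ^+ N)@_b != 0
    & forall i, (b i < p ^ e)%N].
Proof.
have p_gt1 : (1 < p)%N by apply/prime_gt1/(pcharf_prime char_k).
elim: e N => [|e IHe] N hN.
  have N0 : N = 0%N.
    have := hN 0%N (leqnn _); rewrite divn1 muln1 -[X in (_ <= X)%N]add0n.
    by rewrite leq_add2r leqn0 muln_eq0 gtn_eqF //= => /eqP.
  exists ('X_ord0 ^+ d), 0%MM; split.
  - by rewrite mpolyXn dhomogX /= mdegMn mdeg1 mul1n.
  - by rewrite mpolyXn -msupp_eq0 msuppX.
  - by rewrite N0 expr0 mcoeff1 eqxx oner_neq0.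
  - by move=> i; rewrite mnm0E.
have [|f [b [hf f0 fb hb]]] := IHe (N %/ p)%N.
  move=> i ie; have := hN i.+1 ie.
  by rewrite subSS expnS divnMA.
have NE : N = (N %/ p * p + N %% p)%N by apply: divn_eq.
have := @form_pow_add_digit (p ^ e.+1) f (N %/ p * p) (b *+ p)%MM (N %% p).
rewrite -NE; apply=> //.
(* Here [j.+1] is at most the last digit of [N], hence positive and less than [p]. *)
- move=> j hj; rewrite -(dvdn_pcharf char_k) -addnS addnC.
  rewrite dvdn_addl ?dvdn_mull //; apply/negP => /dvdn_leq.
  by have := ltn_mod N p; lia.
- have := mcoeff_frobenius char_k 1 (f ^+ (N %/ p)) b.
  by rewrite exprM expn1 => ->; rewrite expf_neq0.
- by move=> i; rewrite mulmnE expnSr ltn_pmul2r // ltnW.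
- by have := hN 0%N isT; rewrite expn0 divn1 subn0.
Qed.

End Existence.

(** * Common kernels of words in semilinear maps *)

Section Nilpotency.
Variables (k : fieldType) (V : vectType k).

(** Take a subspace of maximal dimension inside [P]: adding the line of any further vector of [P]
    cannot enlarge it. *)
Lemma subspace_vspaceP (P : V -> Prop) :
  P 0 -> (forall a u v, P u -> P v -> P (a *: u + v)) ->
  exists U : {vspace V}, forall v, v \in U <-> P v.
Proof.
move=> P0 PD.
pose dimP m := `[< exists2 U : {vspace V}, \dim U = m & forall v, v \in U -> P v >].
have ex_dim : exists m, dimP m.
  exists 0%N; apply/asboolP; exists 0%VS; first exact: dimv0.
  by move=> v; rewrite memv0 => /eqP ->.
have dim_le m : dimP m -> (m <= \dim {:V})%N.
  by move=> /asboolP[U <- _]; apply/dimvS/subvf.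
case: (ex_maxnP ex_dim dim_le) => m /asboolP[U dimU UP] maxm.
exists U => v; split; [exact: UP | move=> Pv].
suff /eqP -> : U == (U + <[v]>)%VS by apply/(subvP (addvSr _ _))/memv_line.
rewrite eqEdim addvSl /= dimU; apply: maxm; apply/asboolP.
exists (U + <[v]>)%VS => // _ /memv_addP[u uU [_ /vlineP[c ->] ->]].
by rewrite addrC; apply: PD => //; apply: UP.
Qed.

Variables (I : Type) (G : I -> V -> V) (q : nat).
Hypothesis G_semilinear :
  forall i a u v, G i (a *: u + v) = a ^+ q *: G i u + G i v.

Fixpoint killed_by_words (j : nat) (v : V) : Prop :=
  if j is j'.+1 then forall i, killed_by_words j' (G i v) else v = 0.

Let G0 i : G i 0 = 0.
Proof.
have := G_semilinear i 1 0 0.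
by rewrite scaler0 addr0 expr1n scale1r -[LHS]addr0 => /addrI.
Qed.

Let killed0 j : killed_by_words j 0.
Proof. by elim: j => //= j IHj i; rewrite G0. Qed.

Let killedD j a u v :
  killed_by_words j u -> killed_by_words j v -> killed_by_words j (a *: u + v).
Proof.
elim: j a u v => [|j IHj] a u v /=; first by move=> -> ->; rewrite scaler0 addr0.
by move=> hu hv i; rewrite G_semilinear; apply: IHj.
Qed.

Let killedS j v : killed_by_words j v -> killed_by_words j.+1 v.
Proof.
by elim: j v => [|j IHj] v /=; [move=> -> i | move=> hv i; apply: IHj].
Qed.

(* The vectors killed by all words of length j form an increasing chain of
   subspaces, which is constant as soon as two consecutive terms agree. *)
Lemma killed_by_words_dim j v :
  killed_by_words j v -> killed_by_words (\dim {:V}) v.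
Proof.
have [U hU] := choice (fun j => subspace_vspaceP (killed0 j) (@killedD j)).
have killed_le i l w : (i <= l)%N -> killed_by_words i w -> killed_by_words l w.
  by move=> /subnKC <-; elim: (l - i)%N => [|c IHc]; rewrite ?addn0 // addnS;
     move=> hw; apply/killedS/IHc.
have [[i iD stab]|nostab] := pselect (exists2 i, (i <= \dim {:V})%N &
    forall w, killed_by_words i.+1 w -> killed_by_words i w).
  move=> hv; apply: (killed_le i) => //; move: hv.
  move=> /(killed_le j (i + j)%N v (leq_addl _ _)).
  elim: (j) v => [|c IHc] w; rewrite ?addn0 // addnS => /= hw.
  by apply: stab => /= x; apply: IHc.
(* If no two consecutive terms agree, each step raises the dimension, which finally exceeds that of
   [V]. *)
suff : forall i, (i <= (\dim {:V}).+1)%N -> (i <= \dim (U i))%N.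
  by move=> /(_ _ (leqnn _)); rewrite ltnNge dimvS ?subvf.
elim=> // i IHi iD; rewrite (leq_ltn_trans (IHi (ltnW iD))) // ltnNge.
apply/negP => dimU; apply: nostab; exists i => // w.
have subU : (U i <= U i.+1)%VS by apply/subvP => x /hU /killedS /hU.
have /eqP UE : U i == U i.+1 by rewrite eqEdim subU.
by move=> /hU; rewrite -UE => /hU.
Qed.

End Nilpotency.

(** * Appending the same digit block [c] to the exponent: one level decides membership *)

Section Stabilization.
Variables (k : fieldType) (n p d t c : nat).
Hypotheses (char_k : p \in [pchar k]) (d_gt0 : (0 < d)%N).
Hypothesis c_lt : (c < p ^ t)%N.
Implicit Types (f g h : {mpoly k[n]}) (a b : 'X_{1..n}).

Local Notation q := (p ^ t)%N.

(** Split each monomial of [g] as a [q]-th power times a remainder with exponents below [q]; the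
    degree bound on [g] leaves only roots of degree less than [d]. *)
Lemma mcoeff_frobeniusM h g b b' :
  (forall i, (b' i < q)%N) ->
  (forall a, a \in msupp g -> (mdeg a < d * q)%N) ->
  (h ^+ q * g)@_(b *+ q + b') =
  \sum_(a : 'X_{1..n < d}) g@_(a *+ q + b') * (h * 'X_[a])@_b ^+ q.
Proof.
move=> hb' degg; have q_gt0 : (0 < q)%N := leq_ltn_trans (leq0n _) c_lt.
rewrite [g in LHS]mpolyE mulr_sumr raddf_sum /=.
under [RHS]eq_bigr => a _ do rewrite {1}[g]mpolyE raddf_sum mulr_suml /=.
rewrite exchange_big /= big_seq [RHS]big_seq; apply: eq_bigr => m mg.
rewrite -scalerAr mcoeffZ.
under eq_bigr => a _ do rewrite mcoeffZ mcoeffX -mulrA.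
rewrite -mulr_sumr; congr (_ * _).
pose m1 := [multinom (m i %/ q)%N | i < n].
pose m0 := [multinom (m i %% q)%N | i < n].
have hm0 i : (m0 i < q)%N by rewrite mnmE ltn_mod.
have mE : m = (m1 *+ q + m0)%MM.
  by apply/mnmP => i; rewrite mnmDE mulmnE !mnmE; apply: divn_eq.
have degm1 : (mdeg m1 < d)%N.
  rewrite -(ltn_pmul2r q_gt0) -mdegMn; apply: leq_ltn_trans (degg _ mg).
  by rewrite [in X in (_ <= X)%N]mE mdegD leq_addr.
rewrite mE mpolyXD -mpolyXn mulrA -exprMn mcoeff_frobeniusMX //.
under eq_bigr => a _ do rewrite mnm_divE //.
rewrite (bigD1 (BMultinom degm1)) //= eqxx /= big1 ?addr0.
  by case: eqP; rewrite ?mul1r ?mul0r.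
move=> a na; case: eqP => [m1a|]; last by rewrite mul0r.
by case/eqP: na; apply: val_inj.
Qed.

Let coef_space := {ffun 'X_{1..n < d} -> k^o}.

(** A functional on polynomials of degree less than [d], stored by its values on monomials; the
    dimension of this space depends only on [n] and [d]. *)
Definition colon_functional f N b : coef_space :=
  [ffun a : 'X_{1..n < d} => (f ^+ N * 'X_[a])@_b].

Let digit := {b : 'X_{1..n} | forall i, (b i < q)%N}.

(** The recursion of [mcoeff_frobeniusM] for [f ^+ c * 'X_[a]], applied to an arbitrary functional
    [u]; neither [N] nor the leading part of the exponent enters. *)
Definition digit_map f (b : digit) (u : coef_space) : coef_space :=
  [ffun a : 'X_{1..n < d} => \sum_(a' : 'X_{1..n < d})
     (f ^+ c * 'X_[a])@_(a' *+ q + sval b) * (u a' : k) ^+ q].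

Let digit_map_semilinear f (b : digit) x (u v : coef_space) :
  digit_map f b (x *: u + v) = x ^+ q *: digit_map f b u + digit_map f b v.
Proof.
apply/ffunP => a; rewrite !ffunE scaler_sumr -big_split /=.
apply: eq_bigr => a' _; rewrite !ffunE /=.
rewrite exprDn_pchar; last by rewrite pnatX (pnatE _ (pcharf_prime char_k)) char_k.
by rewrite exprMn mulrDr mulrCA.
Qed.

(** Since [c < q], the form [f ^+ c * 'X_[a]] has degree less than [d * q], so test monomials of
    degree less than [d] suffice again. *)
Lemma digit_map_colon f N b (b' : digit) : f \is d.-homog ->
  digit_map f b' (colon_functional f N b) =
  colon_functional f (N * q + c) (b *+ q + sval b')%MM.
Proof.
move=> hf; apply/ffunP => a; rewrite !ffunE exprD exprM -mulrA.
rewrite mcoeff_frobeniusM; last 2 first.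
- exact: svalP b'.
- have hg : f ^+ c * 'X_[a] \is (d * c + mdeg a).-homog.
    by rewrite dhomogM ?dhomogMn ?dhomogX /=.
  move=> m /(dhomog_mf hg) ->; have := bmdeg a => da.
  rewrite (@leq_trans (d * c.+1)) // ?leq_mul2l ?c_lt ?orbT //.
  by rewrite mulnS addnC ltn_add2r.
by apply: eq_bigr => a' _; rewrite ffunE.
Qed.

Lemma frob_power_max_colon f N Q :
  frob_power_max Q (f ^+ N) <->
  forall b, (forall i, (b i < Q)%N) -> colon_functional f N b = 0.
Proof.
have [hN|hN] := pselect (frob_power_max Q (f ^+ N)); split=> //.
  move=> _ b hb; apply/ffunP => a; rewrite !ffunE; apply: contrapT => /eqP.
  have [ab|ab] := boolP (bmnm a <= b)%MM; last by rewrite mcoeffMX_eq0 ?eqxx.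
  rewrite -{1}(submK ab) addmC mcoeffMX => fb.
  have : ~ ~ frob_power_max Q (f ^+ N) by [].
  apply; apply/frob_power_maxP; exists (b - a)%MM => // i.
  by rewrite mnmBE (leq_ltn_trans (leq_subr _ _)).
move=> h0; have [b hb /eqP[]] := (frob_power_maxP _ _).1 hN.
(* The test monomial 1 recovers the coefficient of [f ^+ N] itself. *)
have deg0 : (mdeg (0%MM : 'X_{1..n}) < d)%N by rewrite mdeg0.
have /ffunP/(_ (BMultinom deg0)) := h0 b hb.
by rewrite !ffunE mpolyX0 mulr1.
Qed.

(** A word of length [j] in the digit maps spells the last [j] base [q] digits of an exponent vector
    below [Q * q ^ j]. *)
Lemma killed_colon f N Q j : f \is d.-homog ->
  (forall b, (forall i, (b i < Q)%N) ->
     killed_by_words (digit_map f) j (colon_functional f N b)) <->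
  frob_power_max (Q * q ^ j) (f ^+ iter j (fun N => N * q + c)%N N).
Proof.
have q_gt0 : (0 < q)%N := leq_ltn_trans (leq0n _) c_lt.
move=> hf; elim: j N Q => [|j IHj] N Q.
  by rewrite expn0 muln1; apply: iff_sym; apply: frob_power_max_colon.
rewrite iterSr expnS mulnA; apply: iff_trans (IHj _ _); split=> hk b hb /=.
  pose b1 := [multinom (b i %/ q)%N | i < n].
  pose b0 := [multinom (b i %% q)%N | i < n].
  have hb0 i : (b0 i < q)%N by rewrite mnmE ltn_mod.
  have -> : b = (b1 *+ q + b0)%MM.
    by apply/mnmP => i; rewrite mnmDE mulmnE !mnmE; apply: divn_eq.
  have := hk b1 _ (exist _ b0 hb0); rewrite digit_map_colon //; apply=> i.
  by rewrite mnmE ltn_divLR.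
move=> b'; rewrite digit_map_colon //; apply: hk => i.
rewrite mnmDE mulmnE; have := hb i; have := svalP b' i.
move: (sval b' i) (b i) q_gt0 => x y _ hx hy.
by apply: (@leq_trans (y.+1 * q)); rewrite ?leq_mul2r ?hy ?orbT // mulSn addnC ltn_add2r.
Qed.

Lemma frob_power_max_stabilizes : exists D, forall f N Q j, f \is d.-homog ->
  frob_power_max (Q * q ^ j) (f ^+ iter j (fun N => N * q + c)%N N) ->
  frob_power_max (Q * q ^ D) (f ^+ iter D (fun N => N * q + c)%N N).
Proof.
(* This bound is independent of [f], [N], [Q] and [j]. *)
exists (\dim {:coef_space}) => f N Q j hf.
rewrite -!killed_colon // => hk b hb.
exact: (killed_by_words_dim (digit_map_semilinear f) (hk b hb)).
Qed.

End Stabilization.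

(** * Open sets of projective space and equations for the locus *)

Section ProjectiveOpenSets.
Variables (k : closedFieldType) (V : vectType k).
Implicit Types (u v : V) (P : {mpoly k[\dim {:V}]}).

Lemma coordsD u v i : coords (u + v) i = coords u i + coords v i.
Proof. by rewrite /coords linearD. Qed.

Lemma coordsZ a u i : coords (a *: u) i = a * coords u i.
Proof. by rewrite /coords linearZ. Qed.

Lemma coords_eq0 u : u != 0 -> exists i, coords u i != 0.
Proof.
move=> u0; apply: contrapT => hu; case/eqP: u0.
rewrite [u](coord_vbasis (memvf u)) big1 // => i _.
have -> : coord (vbasis {:V}) i u = 0; last by rewrite scale0r.
by apply: contrapT => /eqP hi; apply: hu; exists i.
Qed.

Lemma meval_coords_line P u v :
  exists h : {poly k}, forall s, h.[s] = P.@[coords (u + s *: (v - u))].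
Proof.
exists (\sum_(m <- msupp P) P@_m *:
  \prod_i ((coords u i)%:P + (coords (v - u) i)%:P * 'X) ^+ m i) => s.
rewrite mevalE horner_sum; apply: eq_bigr => m _.
rewrite hornerZ horner_prod; congr (_ * _); apply: eq_bigr => i _.
by rewrite horner_exp !hornerE [coords (u + s *: _) i]coordsD coordsZ [s * _]mulrC.
Qed.

(** Join [u] to a vector over the other open set by a line: only finitely many of its points violate
    either condition, and the field is infinite. *)
Lemma zariski_dense_nonzero_locus (S : set {mpoly k[\dim {:V}]}) u P :
  S P -> u != 0 -> P.@[coords u] != 0 -> zariski_dense (~` proj_zero_locus S)%classic.
Proof.
move=> SP u0 Pu O [T [_ TE]] [x Ox].
have [Q TQ [v Qv]] : exists2 Q, T Q & exists v, Q.@[coords v] != 0.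
  apply: contrapT => hT; have : (~` O)%classic x; last exact.
  rewrite TE => Q TQ v _; apply: contrapT => /eqP Qv.
  by apply: hT; exists Q => //; exists v.
have [i ui] := coords_eq0 u0.
have [hP hPE] := meval_coords_line P u v.
have [hQ hQE] := meval_coords_line Q u v.
(* A coordinate not vanishing at [u] keeps the chosen point [w] a nonzero vector. *)
have [hi hiE] := meval_coords_line 'X_i u v.
have [s] : exists s, ~~ root (hP * hQ * hi) s.
  apply/closed_nonrootP; rewrite !mulf_neq0 //.
  - by apply: contraNneq Pu => h0; have := hPE 0; rewrite h0 horner0 scale0r addr0 => <-.
  - apply: contraNneq Qv => h0; have := hQE 1.
    by rewrite h0 horner0 scale1r addrC subrK => <-.
  - apply: contraNneq ui => h0; have := hiE 0.
    by rewrite h0 horner0 scale0r addr0 mevalXU => <-.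
rewrite /root !hornerM hPE hQE hiE mevalXU !mulf_eq0 !negb_or.
set w := u + _ => /andP[/andP[Pw Qw] wi].
have w0 : w != 0.
  by apply: contraNneq wi => ->; rewrite /coords linear0.
have dw : \dim <[w]> == 1%N by rewrite dim_vline w0.
exists (exist _ <[w]>%VS dw); split=> /=.
  by move=> /(_ P SP w (memv_line w)) /eqP; apply/negP.
apply: contrapT => nOw; have : (~` O)%classic (exist _ <[w]>%VS dw) by [].
by rewrite TE => /(_ Q TQ w (memv_line w)) /eqP; apply/negP.
Qed.

End ProjectiveOpenSets.

(** Each factor of [f ^ N] contributes one linear form in the coordinates of [f]. These polynomials
    will be the equations of the non-generic locus. *)
Lemma mcoeff_exp_coords (k : fieldType) n d N b :
  exists P : {mpoly k[\dim {:dhomog n.+1 k d}]}, P \is N.-homog /\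
    forall f : dhomog n.+1 k d, P.@[coords f] = ((f : {mpoly k[n.+1]}) ^+ N)@_b.
Proof.
elim: N b => [|N IHN] b.
  exists (b == 0%MM)%:R%:MP; split=> [|f]; last by rewrite mevalC expr0 mcoeff1.
  apply/dhomogP => m; rewrite msuppC; case: ifP => // _.
  by rewrite inE => /eqP ->; rewrite /= mdeg0.
have [P hP] := choice IHN.
pose l m : {mpoly k[\dim {:dhomog n.+1 k d}]} :=
  \sum_(i < \dim {:dhomog n.+1 k d})
  ((vbasis {:dhomog n.+1 k d})`_i : {mpoly k[n.+1]})@_m *: 'X_i.
exists (\sum_(m : 'X_{1..n.+1 < (mdeg b).+1, (mdeg b).+1}
           | b == (m.1 + m.2)%MM) l m.1 * P m.2); split=> [|f].
  apply: rpred_sum => m _; rewrite -(add1n N) dhomogM ?(hP _).1 //.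
  by apply: rpred_sum => i _; rewrite rpredZ // dhomogX /= mdeg1.
rewrite exprS mcoeffM raddf_sum; apply: eq_bigr => m _ /=.
rewrite mevalM (hP _).2; congr (_ * _).
rewrite {2}[f](coord_vbasis (memvf f)) raddf_sum raddf_sum raddf_sum /=.
by apply: eq_bigr => i _; rewrite mevalZ mevalXU mcoeffZ mulrC.
Qed.

(* The numerator N_e of <A / B>_e = N_e / p ^ e, in the form
   ceil (A p ^ e / B) - 1. *)
Definition trunc_num (p A B e : nat) : nat := ((A * p ^ e).-1 %/ B)%N.

(** * Arithmetic of truncation numerators *)

Section TruncationNumerators.
Variables p A B : nat.
Hypotheses (p_gt0 : (0 < p)%N) (A_gt0 : (0 < A)%N) (B_gt0 : (0 < B)%N).

Let ApX_gt0 e : (0 < A * p ^ e)%N.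
Proof. by rewrite muln_gt0 A_gt0 expn_gt0 p_gt0. Qed.

(** For positive [x] and [q] one has [(x * q).-1 %/ q = x.-1], so removing the last [i] digits gives
    the shorter truncation. *)
Lemma trunc_num_div e i :
  (i <= e)%N -> (trunc_num p A B e %/ p ^ i)%N = trunc_num p A B (e - i).
Proof.
move=> ie; rewrite /trunc_num -{1}(subnK ie) expnD mulnA -divnMA [(B * _)%N]mulnC divnMA.
congr (_ %/ _)%N; have := ApX_gt0 (e - i).
have : (0 < p ^ i)%N by rewrite expn_gt0 p_gt0.
case: (A * _)%N (p ^ i)%N => // x [//|q] _ _.
by rewrite mulSn addSn /= addnC divnMDl // divn_small // addn0.
Qed.

Lemma trunc_num_lt e : (B * trunc_num p A B e < A * p ^ e)%N.
Proof.
by rewrite -[ltnRHS](prednK (ApX_gt0 e)) ltnS mulnC leq_trunc_div.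
Qed.

Lemma trunc_num_ge e : (A * p ^ e <= B * (trunc_num p A B e).+1)%N.
Proof.
by rewrite -[leqLHS](prednK (ApX_gt0 e)) [leqRHS]mulnC ltn_ceil.
Qed.

Lemma trunc_num_unique e N :
  (B * N < A * p ^ e)%N -> (A * p ^ e <= B * N.+1)%N -> N = trunc_num p A B e.
Proof.
move=> lt_N le_N; apply/eqP; rewrite eqn_leq.
apply/andP; split; rewrite -ltnS -(ltn_pmul2l B_gt0).
  by apply: leq_trans lt_N (trunc_num_ge _).
exact: leq_trans (trunc_num_lt _) le_N.
Qed.

(* Writing B = p ^ e0 * B' with B' prime to p, the remainders are periodic from
   e0 on, with period totient B', by Euler's theorem. *)
Lemma trunc_num_periodic : prime p -> exists e0 t c,
  [/\ (0 < t)%N, (c < p ^ t)%N & forall j,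
    trunc_num p A B (e0 + t * j) =
      iter j (fun N => N * p ^ t + c)%N (trunc_num p A B e0)].
Proof.
move=> p_pr; pose e0 := logn p B; pose B' := (B`_p^')%N.
pose t := totient B'; pose q := (p ^ t)%N.
have BE : B = (p ^ e0 * B')%N by rewrite -p_part partnC.
have q_gt0 : (0 < q)%N by rewrite expn_gt0 p_gt0.
have dvdB j : (B %| A * p ^ (e0 + t * j) * q.-1)%N.
  rewrite expnD mulnCA -mulnA {1}BE dvdn_mul // dvdn_mull //.
  have : q = 1 %[mod B'].
    apply: Euler_exp_totient; rewrite prime_coprime // /B'.
    by rewrite -p'natE ?part_pnat.
  by move/eqP; rewrite eqn_mod_dvd // subn1.
(* The remainder lies between 1 and [B], to match the ceiling. From [Y = N * B + r] comes
   [Y * q = N * q * B + r * (q - 1) + r], so the repeated digit block is [r * (q - 1) / B]. *)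
pose r := ((A * p ^ e0).-1 %% B).+1.
have step Y : (0 < Y)%N -> (B %| Y * q.-1)%N -> (Y.-1 %% B).+1 = r ->
    ((Y * q).-1 %/ B = Y.-1 %/ B * q + r * q.-1 %/ B)%N /\
    ((Y * q).-1 %% B).+1 = r.
  move=> Y_gt0 dvdY rY; pose N := (Y.-1 %/ B)%N.
  have YE : Y = (N * B + r)%N.
    by rewrite -rY addnS -divn_eq prednK.
  have dvdr : (B %| r * q.-1)%N.
    by move: dvdY; rewrite YE mulnDl dvdn_addr // mulnAC dvdn_mull.
  have rB : (r.-1 < B)%N by rewrite /r /= ltn_mod.
  have E : (Y * q).-1 = ((N * q + r * q.-1 %/ B) * B + r.-1)%N.
    rewrite mulnDl divnK // YE -[r]/(r.-1.+1) -(prednK q_gt0) /=.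
    rewrite mulnDl mulnAC [(_.+1 * q.-1.+1)%N]mulnS [(_.+1 + _)%N]addnC.
    by rewrite addnA addnS.
  by rewrite E divnMDl // modnMDl (divn_small rB) (modn_small rB) addn0.
exists e0, t, (r * q.-1 %/ B)%N; split.
- by rewrite totient_gt0 part_gt0.
- rewrite -/q ltn_divLR // -[in ltnRHS](prednK q_gt0).
  apply: (@leq_ltn_trans (B * q.-1)); first by rewrite leq_mul2r ltn_mod B_gt0 orbT.
  by rewrite mulnC ltn_pmul2r.
- suff hj j : trunc_num p A B (e0 + t * j) =
      iter j (fun N => N * p ^ t + r * q.-1 %/ B)%N (trunc_num p A B e0) /\
      ((A * p ^ (e0 + t * j)).-1 %% B).+1 = r by move=> j; case: (hj j).
  elim: j => [|j [IHj IHr]]; first by rewrite muln0 addn0.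
  have [hdiv hmod] := step _ (ApX_gt0 _) (dvdB j) IHr.
  rewrite mulnS addnA addnAC expnD mulnA hmod iterS -IHj; split=> //.
  by rewrite /trunc_num -hdiv expnD mulnA.
Qed.

End TruncationNumerators.

(** * Bounds on the supremum defining the threshold *)

Section FPureThresholdBounds.
Variables (R : realType) (k : fieldType) (n p : nat).
Implicit Types f : {mpoly k[n]}.

Lemma fpt_le f (v : R) :
  (forall N e, ~ frob_power_max (p ^ e) (f ^+ N) -> N%:R / (p ^ e)%:R <= v) ->
  fpt R p f <= v.
Proof.
move=> hv; apply: ge_sup => [|_ [N [e [hN ->]]]]; last exact: hv.
(* The supremum needs a nonempty set: the constant 1 lies outside the maximal ideal. *)
exists 0; exists 0%N, 0%N; split; last by rewrite mul0r.
apply/frob_power_maxP; exists 0%MM => [i|]; first by rewrite mnm0E.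
by rewrite expr0 mcoeff1 eqxx oner_neq0.
Qed.

Lemma le_fpt f (v : R) N e :
  (forall N e, ~ frob_power_max (p ^ e) (f ^+ N) -> N%:R / (p ^ e)%:R <= v) ->
  ~ frob_power_max (p ^ e) (f ^+ N) -> N%:R / (p ^ e)%:R <= fpt R p f.
Proof.
move=> hv hN; apply: ub_le_sup; last by exists N, e.
by exists v => _ [N' [e' [hN' ->]]]; apply: hv.
Qed.

End FPureThresholdBounds.

Lemma exists_expn_inv_lt (R : realType) (p : nat) (eps : R) :
  (1 < p)%N -> 0 < eps -> exists e0, forall e, (e0 <= e)%N -> ((p ^ e)%:R)^-1 < eps.
Proof.
move=> p_gt1 eps0; exists (Num.bound eps^-1) => e le_e.
rewrite invf_plt ?posrE ?ltr0n ?expn_gt0 ?(ltnW p_gt1) //.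
apply: (lt_le_trans (archi_boundP _)); first by rewrite invr_ge0 ltW.
by rewrite ler_nat (leq_trans le_e) // ltnW // ltn_expl.
Qed.

(** * The generic value is [A / B], given the degree and upper bounds *)

Section GenericFPureThreshold.
Variables (R : realType) (k : closedFieldType) (p n d A B : nat).
Hypotheses (char_k : p \in [pchar k]) (d_gt0 : (0 < d)%N).
Hypotheses (A_gt0 : (0 < A)%N) (B_gt0 : (0 < B)%N).
Hypothesis deg_bound :
  forall e, (d * trunc_num p A B e + n.+1 <= n.+1 * p ^ e)%N.
Hypothesis upper_bound : forall (f : {mpoly k[n.+1]}) N e, f \is d.-homog ->
  ~ frob_power_max (p ^ e) (f ^+ N) -> (N * B <= A * p ^ e)%N.
Implicit Types f : {mpoly k[n.+1]}.

Local Notation M := (trunc_num p A B).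

Let p_gt1 : (1 < p)%N.
Proof. by apply/prime_gt1/(pcharf_prime char_k). Qed.

Let p_gt0 : (0 < p)%N := ltnW p_gt1.

Let pX_gt0 e : (0 < p ^ e)%N.
Proof. by rewrite expn_gt0 p_gt0. Qed.

Lemma frob_power_max_trunc_le f e e' : (e <= e')%N ->
  frob_power_max (p ^ e) (f ^+ M e) -> frob_power_max (p ^ e') (f ^+ M e').
Proof.
move=> le_e hM; apply: contrapT => hM'.
have := frob_power_max_ratio char_k hM' hM; rewrite ltnNge => /negP; apply.
have <- := subKn le_e; rewrite -(trunc_num_div B p_gt0 A_gt0) ?leq_subr //.
rewrite -{3}(subnK le_e) subKn // expnD mulnA leq_mul2r.
by rewrite leq_trunc_div orbT.
Qed.

(** Periodicity makes [M] an iteration of one digit block, to which the stabilization result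
    applies. *)
Lemma frob_power_max_trunc_uniform :
  exists E, forall f e, f \is d.-homog ->
    frob_power_max (p ^ e) (f ^+ M e) -> frob_power_max (p ^ E) (f ^+ M E).
Proof.
have [e0 [t [c [t_gt0 c_lt per]]]] :=
  trunc_num_periodic p_gt0 A_gt0 B_gt0 (pcharf_prime char_k).
have [D hD] := frob_power_max_stabilizes n.+1 char_k d_gt0 c_lt.
exists (e0 + t * D)%N => f e hf he.
rewrite per expnD expnM; apply: (hD _ _ _ e hf); rewrite -per -expnM -expnD.
apply: frob_power_max_trunc_le he.
by rewrite (leq_trans _ (leq_addl _ _)) // leq_pmull.
Qed.

Let fpt_ub f : f \is d.-homog -> forall N e,
  ~ frob_power_max (p ^ e) (f ^+ N) -> N%:R / (p ^ e)%:R <= A%:R / B%:R :> R.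
Proof.
move=> hf N e hN; rewrite ler_pdivrMr ?ltr0n // mulrAC ler_pdivlMr ?ltr0n //.
by rewrite -!natrM ler_nat; apply: upper_bound hN.
Qed.

(** A single membership caps [fpt] at [M e / p ^ e], strictly below [A / B]; conversely these ratios
    come within [p ^ -e] of [A / B]. *)
Lemma fpt_eqP f : f \is d.-homog ->
  fpt R p f = A%:R / B%:R <-> forall e, ~ frob_power_max (p ^ e) (f ^+ M e).
Proof.
move=> hf; split=> [fptE e hM|hM].
  have : fpt R p f <= (M e)%:R / (p ^ e)%:R.
    apply: fpt_le => N e' hN.
    rewrite ler_pdivrMr ?ltr0n // mulrAC ler_pdivlMr ?ltr0n //.
    by rewrite -!natrM ler_nat ltnW // (frob_power_max_ratio char_k hN).
  rewrite fptE leNgt ltr_pdivrMr ?ltr0n // mulrAC ltr_pdivlMr ?ltr0n //.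
  by rewrite -!natrM ltr_nat mulnC trunc_num_lt.
apply/le_anti/andP; split; first by apply: fpt_le; apply: fpt_ub.
apply/ler_addgt0Pr => eps eps0.
have [e /(_ e (leqnn _)) he] := exists_expn_inv_lt p_gt1 eps0.
apply: (le_trans _ (lerD (le_fpt (fpt_ub hf) (hM e)) (ltW he))).
rewrite -[X in _ + X]mul1r -mulrDl natr1.
rewrite ler_pdivrMr ?ltr0n // mulrAC ler_pdivlMr ?ltr0n //.
by rewrite -!natrM ler_nat [leqRHS]mulnC trunc_num_ge.
Qed.

Lemma is_generic_fpt_trunc : is_generic_fpt k p n d (A%:R / B%:R : R).
Proof.
have [E hE] := frob_power_max_trunc_uniform.
have fptP (f : dhomog n.+1 k d) : fpt R p f = A%:R / B%:R <->
    exists2 b : 'X_{1..n.+1}, (forall i, (b i < p ^ E)%N) &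
      ((f : {mpoly k[n.+1]}) ^+ M E)@_b != 0.
  rewrite (fpt_eqP (dhomog_is_dhomog f)) -frob_power_maxP.
  split=> [|hfE e he]; first exact.
  by apply: hfE; apply: hE he; apply: dhomog_is_dhomog.
have [f0 [b0 [hf0 f0_neq0 fb0 hb0]]] :
    exists f b, [/\ f \is d.-homog, f != 0, (f ^+ M E)@_b != 0
      & forall i, (b i < p ^ E)%N].
  apply: exists_form_pow_notin => // i iE.
  by rewrite (trunc_num_div B p_gt0).
pose F0 : dhomog n.+1 k d := DHomog hf0.
have F0_neq0 : F0 != 0 by [].
have [P hP] := choice (@mcoeff_exp_coords k n d (M E)).
pose S := [set Q | exists2 b : 'X_{1..n.+1},
  (forall i, (b i < p ^ E)%N) & Q = P b]%classic.
have locusE : fpt_locus (k := k) (n := n) (d := d) p (A%:R / B%:R : R) =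
    (~` proj_zero_locus S)%classic.
  apply/seteqP; split=> [x hx hS|x hx f fx f0'].
    have xn0 : vpick (val x) != 0.
      by rewrite vpick0 -dimv_eq0 (eqP (valP x)).
    have [b hb] := (fptP _).1 (hx _ (memv_pick _) xn0).
    by rewrite -(hP b).2 hS ?eqxx ?memv_pick //; exists b.
  apply/fptP; apply: contrapT => hf; apply: hx => _ [b hb ->] u ux.
  (* Every vector of the line is a multiple of [f], so its coefficients in the power [M E] vanish
     with those of [f]. *)
  have /vlineP[c ->] : u \in <[f]>%VS.
    suff /eqP -> : <[f]>%VS == val x by [].
    rewrite eqEdim dim_vline f0' (eqP (valP x)) andbT.
    by apply/subvP => _ /vlineP[c ->]; rewrite memvZ.
  rewrite (hP b).2 /= exprZn mcoeffZ.
  suff -> : ((f : {mpoly k[n.+1]}) ^+ M E)@_b = 0 by rewrite mulr0.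
  by apply: contrapT => /eqP fb; apply: hf; exists b.
split.
- split; first by exists F0; split=> //; apply/fptP; exists b0.
  by move=> f _; apply: fpt_le; apply: fpt_ub; apply: dhomog_is_dhomog.
- exists S; split; last by rewrite locusE setCK.
  by move=> _ [b _ ->]; exists (M E); apply: (hP b).1.
- rewrite locusE; apply: (zariski_dense_nonzero_locus (P := P b0) _ F0_neq0).
    by exists b0.
  by rewrite (hP b0).2.
Qed.

End GenericFPureThreshold.

(** * Non-terminating expansions of a rational number *)

Section BaseExpansions.
Variables (R : realType) (p A B : nat).
Hypotheses (p_gt1 : (1 < p)%N) (A_gt0 : (0 < A)%N) (le_AB : (A <= B)%N).

Local Notation M := (trunc_num p A B).
Local Notation lam := (A%:R / B%:R : R).

Let p_gt0 : (0 < p)%N := ltnW p_gt1.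

Let B_gt0 : (0 < B)%N := leq_trans A_gt0 le_AB.

Let pX_gt0 e : 0 < (p ^ e)%:R :> R.
Proof. by rewrite ltr0n expn_gt0 p_gt0. Qed.

Lemma trunc_num0 : M 0%N = 0%N.
Proof. by rewrite /trunc_num muln1 divn_small // prednK. Qed.

Lemma trunc_numS e : M e.+1 = (M e * p + M e.+1 %% p)%N.
Proof.
rewrite {1}(divn_eq (M e.+1) p) -[X in (_ %/ X)%N]expn1.
by rewrite (trunc_num_div B p_gt0 A_gt0) // subn1.
Qed.

Fixpoint digits_num (a : nat -> nat) (e : nat) : nat :=
  if e is e'.+1 then (digits_num a e' * p + a e')%N else 0%N.

Lemma sum_expansion_term a e :
  \sum_(i < e) expansion_term R p a i = (digits_num a e)%:R / (p ^ e)%:R.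
Proof.
elim: e => [|e IHe]; first by rewrite big_ord0 mul0r.
rewrite big_ord_recr /= IHe /expansion_term natrD mulrDl; congr (_ + _).
by rewrite expnSr !natrM -mulf_div divff ?mulr1 // pnatr_eq0 -lt0n.
Qed.

Lemma ratio_approx e :
  (M e)%:R / (p ^ e)%:R < lam /\ lam <= (M e)%:R / (p ^ e)%:R + ((p ^ e)%:R)^-1.
Proof.
split.
  rewrite ltr_pdivrMr // mulrAC ltr_pdivlMr ?ltr0n //.
  by rewrite -!natrM ltr_nat mulnC trunc_num_lt.
rewrite -[X in _ + X]mul1r -mulrDl natr1.
rewrite ler_pdivrMr ?ltr0n // mulrAC ler_pdivlMr //.
by rewrite -!natrM ler_nat [leqRHS]mulnC trunc_num_ge.
Qed.

Lemma trunc_num_expansion :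
  nonterminating_expansion p lam (fun i => M i.+1 %% p)%N.
Proof.
split=> [i|m|]; first by rewrite ltn_mod.
- apply: contrapT => hm.
  have hM j : M (m + j) = (M m * p ^ j)%N.
    elim: j => [|j IHj]; first by rewrite addn0 muln1.
    rewrite addnS trunc_numS IHj expnSr mulnA [(M _ %% p)%N](_ : _ = 0%N) ?addn0 //.
    apply: contrapT => /eqP h0; apply: hm.
    by exists (m + j)%N; rewrite ?leq_addr // addnS.
  (* Zero digits from [m] on contradict the strict bound at [m]; [B] further digits suffice since
     [B < p ^ B]. *)
  have := trunc_num_ge p_gt0 A_gt0 B_gt0 (m + B); rewrite leqNgt => /negP; apply.
  rewrite hM expnD mulnA mulnS mulnA.
  apply: (@leq_trans ((B * M m).+1 * p ^ B)).
    by rewrite mulSn ltn_add2r ltn_expl.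
  by rewrite leq_mul2r trunc_num_lt ?orbT.
- apply/cvgrPdist_le => eps eps0.
  have [e0 he0] := exists_expn_inv_lt p_gt1 eps0.
  exists e0 => // e /= /he0 he; rewrite /series /= big_mkord sum_expansion_term.
  have -> : digits_num (fun i => M i.+1 %% p)%N e = M e.
    by elim: e {he} => [|e IHe]; rewrite ?trunc_num0 //= IHe -trunc_numS.
  have [lt_lam le_lam] := ratio_approx e.
  rewrite ger0_norm; last by rewrite subr_ge0 ltW.
  rewrite lerBlDl.
  by rewrite (le_trans le_lam) // lerD2l ltW.
Qed.

(** Infinitely many nonzero digits keep partial sums strictly below the limit, and digits below [p]
    bound the tail by [p ^ -e]; these inequalities determine the numerator. *)
Lemma digits_num_trunc a e :
  nonterminating_expansion p lam a -> digits_num a e = M e.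
Proof.
move=> [ha nt cv].
have S_E i : series (expansion_term R p a) i = (digits_num a i)%:R / (p ^ i)%:R.
  by rewrite /series /= big_mkord sum_expansion_term.
have term_ge0 i : 0 <= expansion_term R p a i.
  by rewrite divr_ge0 // ler0n.
have S_homo : {homo series (expansion_term R p a) : i j / (i <= j)%N >-> i <= j}.
  move=> i j ij; rewrite -(subnKC ij) /series /= [leRHS](big_cat_nat (n := i)) //=.
    by rewrite lerDl sumr_ge0.
  by rewrite leq_addr.
have S_le i : series (expansion_term R p a) i <= lam.
  rewrite -(cvg_lim (@Rhausdorff R) cv); apply: limr_ge.
    by apply/cvg_ex; exists lam.
  by exists i => // j /= /S_homo.
have S_lt i : series (expansion_term R p a) i < lam.
  have [j ij aj] := nt i; apply: lt_le_trans (S_le j.+1).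
  apply: (le_lt_trans (S_homo _ _ ij)).
  rewrite /series /= big_nat_recr //= ltrDl divr_gt0 //.
  by rewrite ltr0n lt0n.
have tail j : ((digits_num a (e + j)).+1 <= (digits_num a e).+1 * p ^ j)%N.
  elim: j => [|j IHj]; first by rewrite addn0 muln1.
  rewrite addnS /= expnSr mulnA.
  apply: (@leq_trans ((digits_num a (e + j)).+1 * p)); last by rewrite leq_mul2r IHj orbT.
  by rewrite mulSn addnC ltn_add2r.
have S_ge : lam <= (digits_num a e).+1%:R / (p ^ e)%:R.
  rewrite -(cvg_lim (@Rhausdorff R) cv); apply: limr_le.
    by apply/cvg_ex; exists lam.
  exists e => // i /= /subnKC <-; rewrite S_E.
  rewrite ler_pdivrMr // mulrAC ler_pdivlMr // -!natrM ler_nat.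
  rewrite expnD mulnA mulnAC leq_mul2r; apply/orP; right.
  exact: ltnW.
apply: trunc_num_unique => //.
  have := S_lt e; rewrite S_E ltr_pdivrMr // mulrAC ltr_pdivlMr ?ltr0n //.
  by rewrite -!natrM ltr_nat mulnC.
move: S_ge; rewrite ler_pdivrMr ?ltr0n // mulrAC ler_pdivlMr //.
by rewrite -!natrM ler_nat [leqRHS]mulnC.
Qed.

Lemma truncationE e : truncation p lam e = (M e)%:R / (p ^ e)%:R.
Proof.
rewrite /truncation sum_expansion_term digits_num_trunc //.
by apply: getPex; exists (fun i => M i.+1 %% p)%N; apply: trunc_num_expansion.
Qed.

End BaseExpansions.

(** * The conditions on [L] and the generic value *)

Lemma natr_div_intP (m d : nat) : (0 < d)%N ->
  reflect ((m%:R / d%:R : rat) \is a Num.int) (d %| m)%N.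
Proof.
move=> d_gt0; have d_neq0 : d%:R != 0 :> rat by rewrite pnatr_eq0 -lt0n.
apply: (iffP idP) => [/dvdnP[c ->]|/intrP[z /(canRL (divfK d_neq0))]].
  by rewrite natrM mulfK // rpred_nat.
rewrite -[d%:R]/(d%:Z%:~R) -[m%:R]/(m%:Z%:~R) -intrM => /intr_inj mE.
by rewrite -[(_ %| _)%N]/(d%:Z %| m%:Z)%Z mE dvdz_mull.
Qed.

(** These are the levels where the degree bound fails. If [d] does not divide [n.+1 * p ^ e], the
    difference from [d * trunc_num p n.+1 d e] is the remainder; otherwise it is [d], which is at
    least [n.+1]. *)
Lemma truncation_placeP (p n d e : nat) : (0 < p)%N -> (0 < d)%N -> (n.+1 <= d)%N ->
  truncation_place p n.+1 d e <->
  (0 < e)%N /\ (n.+1 * p ^ e < d * trunc_num p n.+1 d e + n.+1)%N.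
Proof.
move=> p_gt0 d_gt0 le_nd; rewrite /truncation_place /trunc_num mulrA -natrM.
rewrite [(p ^ e * _)%N]mulnC; have : (0 < n.+1 * p ^ e)%N.
  by rewrite muln_gt0 expn_gt0 p_gt0.
case: (n.+1 * p ^ e)%N => // x _ /=.
have [dvd_dx|ndvd_dx] := boolP (d %| x.+1)%N.
  split=> [[_ /negP[]]|[_]]; first exact/natr_div_intP.
  have /dvdnP[[|c] xE] := dvd_dx; first by rewrite mul0n in xE.
  have -> : x = (c * d + d.-1)%N.
    by apply: succn_inj; rewrite xE mulSn addnC -addnS prednK.
  rewrite divnMDl // divn_small ?prednK // addn0 mulnC -addnS prednK //.
  by rewrite ltnNge leq_add2l le_nd.
have -> : (x %/ d = x.+1 %/ d)%N by rewrite divnS // (negbTE ndvd_dx).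
rewrite [X in _ <-> _ /\ (X < _)%N](divn_eq x.+1 d) [(_ %/ d * d)%N]mulnC ltn_add2l.
split=> [[e_gt0 _ h]|[e_gt0 h]]; split=> //.
by apply: contra ndvd_dx => /natr_div_intP; apply.
Qed.

Theorem theorem4p2 (R : realType) (k : closedFieldType) (p n d : nat)
    (char_k : p \in [pchar k]) (le_nd : (n.+1 <= d)%N) :
  (forall L : nat,
     truncation_place p n.+1 d L ->
     (forall L' : nat, truncation_place p n.+1 d L' -> (L <= L')%N) ->
     is_generic_fpt k p n d (truncation p (n.+1%:R / d%:R : R) L)) /\
  ((forall L : nat, ~ truncation_place p n.+1 d L) ->
     is_generic_fpt k p n d (n.+1%:R / d%:R : R)).
Proof.
have p_gt1 : (1 < p)%N by apply/prime_gt1/(pcharf_prime char_k).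
have p_gt0 := ltnW p_gt1.
have pX_gt0 e : (0 < p ^ e)%N by rewrite expn_gt0 p_gt0.
have d_gt0 : (0 < d)%N := leq_trans (ltn0Sn n) le_nd.
have not_place e : ~ truncation_place p n.+1 d e ->
    (d * trunc_num p n.+1 d e + n.+1 <= n.+1 * p ^ e)%N.
  have [->|e_gt0] := posnP e; first by rewrite trunc_num0 // muln0 muln1.
  by move=> nplace; rewrite leqNgt; apply/negP => ?; apply/nplace/truncation_placeP.
split=> [L placeL minL|noL]; last first.
  apply: is_generic_fpt_trunc => // [e|f N e hf]; first exact: not_place.
  move=> /(frob_power_max_deg hf) /(leq_trans (leq_addr _ _)).
  by rewrite mulnC.
(* The truncation is the fraction [A / p ^ L], so [B] is now [p ^ L]. *)
rewrite truncationE //; set A := trunc_num p n.+1 d L.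
have [_ ltL] := (truncation_placeP L p_gt0 d_gt0 le_nd).1 placeL.
have lt_A : (d * A < n.+1 * p ^ L)%N by apply: trunc_num_lt.
have A_gt0 : (0 < A)%N.
  rewrite lt0n; apply: contraTneq ltL; rewrite -/A => ->.
  by rewrite muln0 -leqNgt leq_pmulr.
apply: is_generic_fpt_trunc => // [e|f N e hf].
  set T := trunc_num p A (p ^ L) e.
  have lt_T : (p ^ L * T < A * p ^ e)%N by apply: trunc_num_lt.
  (* From [L] on, [T + 1] is at most [A * p ^ (e - L)], and [n.+1 <= d] gives the bound. Before [L],
     [T] is at most the numerator for [n.+1 / d], where minimality of [L] applies. *)
  have [le_Le|lt_eL] := leqP L e.
    have : (T < A * p ^ (e - L))%N.
      by rewrite -(ltn_pmul2l (pX_gt0 L)) mulnCA -expnD subnKC.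
    rewrite -(leq_pmul2l d_gt0) mulnS mulnA => le_T.
    rewrite addnC (@leq_trans (d + d * T)) ?leq_add2r // (leq_trans le_T) //.
    by rewrite -[in leqRHS](subnKC le_Le) expnD mulnA leq_mul2r ltnW ?orbT.
  apply: (@leq_trans (d * trunc_num p n.+1 d e + n.+1)); last first.
    by apply: not_place => /minL; rewrite leqNgt lt_eL.
  rewrite leq_add2r leq_mul2l -ltnS -(ltn_pmul2l d_gt0).
  rewrite (leq_trans _ (trunc_num_ge _ _ _ e)) ?orbT //.
  rewrite -(ltn_pmul2l (pX_gt0 L)) mulnCA.
  apply: (@leq_ltn_trans (d * (A * p ^ e))); first by rewrite leq_mul2l ltnW ?orbT.
  by rewrite !mulnA ltn_pmul2r // [(p ^ L * _)%N]mulnC.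
(* By degree, [f ^ A] lies in the Frobenius power of level [L] for every form [f]. *)
move=> hN; apply/ltnW/(frob_power_max_ratio char_k hN).
by apply: contrapT => /(frob_power_max_deg hf); rewrite leqNgt ltL.
Qed.
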